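(* Let $n\ge 1$ and let $f\colon S^1\to D_n(S^1)$ be an $n$-valued map of degree $d\neq n$. Then $R(f)=|d-n|$.
   Context: $S^1$ is the set of complex numbers of norm one, with universal covering $p\colon\mathbb R\to S^1$, $p(t)=e^{2\pi i t}$, and $\mathbb Z=\pi_1(S^1)$ acting on $\mathbb R$ by translations. $D_n(S^1)$ is the set of $n$-element subsets of $S^1$, topologized as the quotient by the symmetric group $\Sigma_n$ of $F_n(S^1)=\{(x_1,\dots,x_n)\in (S^1)^n\mid x_i\neq x_j\text{ for }i\ne j\}$. An $n$-valued map is a continuous map $f\colon S^1\to D_n(S^1)$; homotopies of $n$-valued maps are continuous maps $S^1\times[0,1]\to D_n(S^1)$. For $d\in\mathbb Z$ let $\phi_{n,d}\colon S^1\to D_n(S^1)$ send $z$ to the set of $n$-th roots of $z^d$. Every $n$-valued map $f\colon S^1\to D_n(S^1)$ is homotopic to $\phi_{n,d}$ for a unique integer $d$, called the degree of $f$ (a known result). Let $F_n(\mathbb R,\mathbb Z)=\{(t_1,\dots,t_n)\in\mathbb R^n\mid t_i-t_j\notin\mathbb Z\text{ for }i\ne j\}$. A lifting of $f$ is a continuous map $\bar f=(\bar f_1,\dots,\bar f_n)\colon\mathbb R\to F_n(\mathbb R,\mathbb Z)$ with $f(p(t))=\{p(\bar f_1(t)),\dots,p(\bar f_n(t))\}$ for all $t$; the coordinate maps $\bar f_i\colon\mathbb R\to\mathbb R$ of all liftings are the lift-factors of $f$. Two lift-factors $g,h$ are equivalent if there is $k\in\mathbb Z$ with $g(t)=k+h(t-k)$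 for all $t$. The Reidemeister number $R(f)$ is the number (possibly $\infty$) of equivalence classes of lift-factors. *)

(* Defs.v *)
From HB Require Import structures.
From mathcomp Require Import all_boot all_order all_algebra all_field.
From mathcomp Require Import all_classical all_reals all_analysis.
From mathcomp Require Import complex.

Set Implicit Arguments.
Unset Strict Implicit.
Unset Printing Implicit Defensive.

Import Order.TTheory GRing.Theory Num.Theory.
Import numFieldNormedType.Exports.

Local Open Scope classical_set_scope.
Local Open Scope ring_scope.

(* The usual topology of the complex numbers: R[i] is given the topology of
   its norm, as a normed module over itself. *)
HB.instance Definition _ (R : realType) := NormedModule.copy R[i] R[i]^o.

(* Here and below a set coerces to the type of its elements, topologized as a
   subspace. *)
Definition S1 (R : realType) : set R[i] := [set z | `|z| = 1].
Arguments S1 : clear implicits.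

(* exp (2 i pi t) *)
Definition cis (R : realType) (t : R) : R[i] :=
  (cos (2 * pi * t) +i* sin (2 * pi * t))%C.

Lemma cis_S1 (R : realType) (t : R) : cis t \in S1 R.
Proof. by apply/mem_set; rewrite /S1/= normc_def/= cos2Dsin2 sqrtr1. Qed.

Definition p (R : realType) (t : R) : S1 R := exist _ (cis t) (cis_S1 t).

Definition conf (T : topologicalType) (n : nat) : set {ptws 'I_n -> T} :=
  [set x : {ptws 'I_n -> T} | injective (x : 'I_n -> T)].
Arguments conf : clear implicits.

Definition nsubset (T : Type) (n : nat) : set (set T) :=
  [set A | (A #= `I_n)%card].
Arguments nsubset : clear implicits.

Lemma card_range_inj (T : Type) (n : nat) (x : 'I_n -> T) :
  injective x -> (range x #= `I_n)%card.
Proof.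
move=> xI; have xinj : {in [set: 'I_n] &, injective x} by move=> i j _ _; exact: xI.
apply: card_eq_trans (inj_card_eq xinj) _.
by rewrite card_eq_sym; exact: card_II.
Qed.

Lemma range_nsubset (T : topologicalType) (n : nat) (x : conf T n) :
  range (set_val x : 'I_n -> T) \in nsubset T n.
Proof. apply/mem_set; apply: card_range_inj.
exact: (set_mem (valP x)).
Qed.

Definition conf_to_nsubset (T : topologicalType) (n : nat) (x : conf T n) :
  nsubset T n :=
  exist _ (range (set_val x : 'I_n -> T)) (range_nsubset x).

Lemma conf_to_nsubset_surj (T : topologicalType) (n : nat) (A : nsubset T n) :
  exists x, conf_to_nsubset x = A.
Proof.
have /set_mem/= AI := valP A.
have /card_eqP[f] : ([set: 'I_n] #= val A)%card.
  by rewrite (card_eqr AI) card_eq_sym; exact: card_II.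
pose x : 'I_n -> T := fun i => val (f (exist _ i (mem_set I))).
have xI : x \in conf T n.
  apply/mem_set => i j /val_inj eqf.
  have /(congr1 val) := 'inj_f (mem_set I) (mem_set I) eqf.
  exact.
exists (exist _ x xI); apply/val_inj => /=.
rewrite eqEsubset; split => [_ [i _ <-]|a Aa]; first exact/set_mem/valP.
pose b : val A := exist _ a (mem_set Aa).
have [[i iT] _ fib] : [set f x | x in [set: [set: 'I_n]]] b.
  exact: (@surj _ _ _ _ f b I).
exists i => //; rewrite -[a]/(val b) -fib /= /x.
by congr (val (f _)); exact: val_inj.
Qed.

Definition enum_nsubset (T : topologicalType) (n : nat) (A : nsubset T n) :
  conf T n := sval (cid (conf_to_nsubset_surj A)).

Lemma enum_nsubsetK (T : topologicalType) (n : nat) :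
  cancel (@enum_nsubset T n) (@conf_to_nsubset T n).
Proof. by move=> A; rewrite /enum_nsubset; case: cid. Qed.

Definition unordered (T : topologicalType) (n : nat) : Type := nsubset T n.

HB.instance Definition _ (T : topologicalType) (n : nat) :=
  isQuotient.Build (conf T n) (unordered T n) (@enum_nsubsetK T n).

(* The n-element subsets of T with the quotient topology of the surjection
   x |-> {x_1, ..., x_n}, whose fibers are the orbits of the symmetric group. *)
Definition D (T : topologicalType) (n : nat) : topologicalType :=
  quotient_topology (unordered T n).
Arguments D : clear implicits.

Definition elements (T : topologicalType) (n : nat) (A : D T n) : set T :=
  set_val (A : nsubset T n).

Lemma elements_pi (T : topologicalType) (n : nat) (x : conf T n) :
  elements (\pi_(D T n)%qT x) = range (set_val x : 'I_n -> T).
Proof. by rewrite !unlock. Qed.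

Lemma roots_nsubset (R : realType) (n : nat) (n_gt0 : (0 < n)%N) (d : int)
    (z : S1 R) :
  [set w : S1 R | set_val w ^+ n = set_val z ^ d] \in nsubset (S1 R) n.
Proof.
apply/mem_set => /=.
have n_neq0 : n%:R != 0 :> R[i] by rewrite pnatr_eq0 -lt0n.
have [r] := closed_field_poly_normal ('X^n - 1 : {poly R[i]}).
rewrite (monicP _) ?monicXnsubC// scale1r => rE.
have r_uniq : uniq r.
  by rewrite -(@separable_prod_XsubC R[i]) -rE separable_Xn_sub_1.
have r_size : size r = n.
  by apply/eqP; rewrite -eqSS -(@size_prod_XsubC _ _ r id) -rE size_XnsubC.
have rP u : (u \in r) = (u ^+ n == 1).
  by rewrite -root_prod_XsubC -rE rootE !hornerE subr_eq0.
have z1 : `|set_val z| = 1 by exact: (set_mem (valP z)).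
set c := set_val z ^ d.
have c1 : `|c| = 1.
  by rewrite /c; case: (d) => k; rewrite ?NegzE ?normfV normrX z1 expr1n ?invr1.
have norm1 (u : R[i]) : `|u| ^+ n = 1 -> `|u| = 1.
  by move=> /eqP; rewrite pexpr_eq1// => /eqP.
set x := n.-root c.
have xn : x ^+ n = c by rewrite /x rootCK.
have x0 : x != 0.
  by apply/eqP => x0; move: c1; rewrite -xn x0 expr0n gtn_eqF// normr0 => /esym/eqP; rewrite oner_eq0.
have yS1 (i : 'I_n) : x * r`_i \in S1 R.
  apply/mem_set/norm1; have : r`_i \in r by rewrite mem_nth// r_size.
  by rewrite -normrX exprMn xn rP => /eqP ->; rewrite mulr1.
pose y (i : 'I_n) : S1 R := exist _ (x * r`_i) (yS1 i).
have yI : injective y.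
  move=> i j /(congr1 set_val) /= /(mulfI x0) /eqP.
  by rewrite nth_uniq ?r_size// => /eqP/val_inj.
rewrite (_ : [set w | _] = range y); first exact: card_range_inj.
rewrite eqEsubset; split => [w /= wn|_ [i _ <-] /=]; last first.
  have : r`_i \in r by rewrite mem_nth// r_size.
  by rewrite exprMn xn rP => /eqP ->; rewrite mulr1.
have ur : set_val w / x \in r.
  by rewrite rP expr_div_n wn xn divff// -normr_eq0 c1 oner_eq0.
have ilt : (index (set_val w / x) r < n)%N by rewrite -r_size index_mem.
exists (Ordinal ilt) => //; apply/val_inj => /=.
by rewrite nth_index// mulrC divfK.
Qed.

(* The map sending z to the set of n-th roots of z ^ d; the
   n-th roots in R[i] of a number of norm 1 have norm 1. *)
Definition phi (R : realType) (n : nat) (n_gt0 : (0 < n)%N) (d : int)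
    (z : S1 R) : D (S1 R) n :=
  exist _ [set w : S1 R | set_val w ^+ n = set_val z ^ d]
    (roots_nsubset n_gt0 d z).

(* A homotopy X x [0, 1] -> Y is a map on X * R, continuous on X x [0, 1]; its
   values elsewhere are irrelevant. *)
Definition homotopic (X Y : topologicalType) (R : realType) (f g : X -> Y) :=
  exists H : X * R -> Y,
    [/\ {within [set: X] `*` `[0, 1], continuous H},
        forall x, H (x, 0) = f x
      & forall x, H (x, 1) = g x].

Definition has_degree (R : realType) (n : nat) (n_gt0 : (0 < n)%N)
  (f : S1 R -> D (S1 R) n) (d : int) := homotopic R f (phi n_gt0 d).

Definition confZ (R : realType) (n : nat) : set {ptws 'I_n -> R} :=
  [set t : {ptws 'I_n -> R} | forall i j, i != j -> t i - t j \isn't a Num.int].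
Arguments confZ : clear implicits.

Definition lifting (R : realType) (n : nat) (f : S1 R -> D (S1 R) n)
    (fbar : R -> confZ R n) :=
  continuous fbar /\
  forall t : R,
    elements (f (p t)) = [set p (set_val (fbar t) i) | i in [set: 'I_n]].

Definition lift_factor (R : realType) (n : nat) (f : S1 R -> D (S1 R) n) :
    set (R -> R) :=
  [set g | exists (fbar : R -> confZ R n) (i : 'I_n),
    lifting f fbar /\ g = (fun t => set_val (fbar t) i)].

Definition lift_factor_equiv (R : realType) (g h : R -> R) :=
  exists k : int, forall t, g t = k%:~R + h (t - k%:~R).

Definition lift_factor_classes (R : realType) (n : nat)
    (f : S1 R -> D (S1 R) n) : set (set (R -> R)) :=
  [set [set h | lift_factor f h /\ lift_factor_equiv g h] | g in lift_factor f].

(* counting is +oo on infinite sets. *)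
Definition reidemeister_number (R : realType) (n : nat)
    (f : S1 R -> D (S1 R) n) : \bar R :=
  counting (lift_factor_classes f).

(* Main.v *)
Require Import Defs.
From mathcomp Require Import all_boot all_order all_algebra.
From mathcomp Require Import all_classical all_reals all_analysis.
From mathcomp Require Import complex ring lra zify.

Set Implicit Arguments.
Unset Strict Implicit.

Import Order.TTheory GRing.Theory Num.Theory.
Import numFieldNormedType.Exports.

Local Open Scope ring_scope.
Local Open Scope classical_set_scope.

(** The set of real numbers lying over the n-element set f (p t) is invariant
under integer translations and has n points per period.  Listing it in
increasing order for all t at once, continuously in t, gives functions
E m : R -> R indexed by the integers, with E (m + n) = E m + 1.  Going once
around the circle brings the set back to itself and preserves the order, so
that E m (t + 1) = E (m + d') t for some integer d'.

This d' is the degree.  For phi_(n,d) the enumeration is explicit,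
E m t = (d t + m) / n, and d' = d.  Along a homotopy, the enumeration at one
time is carried to a nearby time by replacing each point by the closest point
of the new set ([enumeration_near]); this preserves both relations above.  By
compactness of the square of parameters there is a time step that is small
enough everywhere ([enumeration_clamp]), so the enumeration of phi_(n,d)
reaches f with d' = d.  Liftings of f are thus obtained together with the
effect on them of one turn around the circle.

The topology of the space of n-element subsets enters in one way only: a point
of f x persists in f y for y near x ([open_meet], [fiber_lsc]).  Since all the
sets have n elements, the persisting points are all there is, which gives
closeness in the other direction and a uniform gap between points
([fiber_near]).

The lift-factors of f are exactly the E m ([lift_factorP]): by the intermediate
value theorem a continuous choice of points cannot jump across the midpoint
between two consecutive E m.  Finally k + E m (t - k) = E (m + k (n - d)) t, so
the equivalence of lift-factors is congruence modulo n - d on the indices, and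
there are |d - n| classes. *)

(** * The universal covering of the circle *)

Lemma cisD (R : realType) (a b : R) : cis (a + b) = cis a * cis b.
Proof.
rewrite /cis mulrDr cosD sinD; apply/eqP.
by rewrite eq_complex /= eqxx /= addrC.
Qed.

Lemma cis0 (R : realType) : cis (0 : R) = 1.
Proof. by rewrite /cis mulr0 cos0 sin0. Qed.

Lemma cis_neq0 (R : realType) (a : R) : cis a != 0.
Proof.
apply/eqP => h; have := cisD a (- a).
by rewrite subrr cis0 h mul0r => /eqP; rewrite oner_eq0.
Qed.

Lemma cisN (R : realType) (a : R) : cis (- a) = (cis a)^-1.
Proof.
apply: (mulfI (cis_neq0 a)).
by rewrite -cisD subrr cis0 divff // cis_neq0.
Qed.

Lemma cis_natmul (R : realType) (a : R) (k : nat) :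
  cis (k%:R * a) = cis a ^+ k.
Proof.
elim: k => [|k IH]; first by rewrite mul0r cis0.
by rewrite -natr1 mulrDl mul1r cisD IH exprSr.
Qed.

Lemma cis_intmul (R : realType) (a : R) (d : int) :
  cis (d%:~R * a) = cis a ^ d.
Proof.
case: d => k; first exact: cis_natmul.
by rewrite NegzE mulrNz mulNr cisN cis_natmul -exprnN.
Qed.

Lemma cis_int (R : realType) (k : int) : cis (k%:~R : R) = 1.
Proof.
rewrite -[k%:~R]mulr1 cis_intmul /cis mulr1.
have -> : 2 * pi = pi *+ 2 :> R by rewrite mulr_natl.
by rewrite cos2pi sin2pi exp1rz.
Qed.

(** After removing the integer part of a, the double angle formula reduces the
claim to the positivity of the sine on the open half period. *)
Lemma cis_eq1 (R : realType) (a : R) : (cis a = 1) <-> (a \is a Num.int).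
Proof.
split=> [|/intrP[k ->]]; last exact: cis_int.
set b := a - (Num.floor a)%:~R => a1.
have : cis b = 1 by rewrite cisD a1 cisN cis_int invr1 mulr1.
have b0 : 0 <= b by rewrite subr_ge0 ge_floor.
have b1 : b < 1 by rewrite ltrBlDl; have := floorD1_gt a; rewrite intrD.
have [b_eq0 _|b_neq0] := eqVneq b 0.
  apply/intrP; exists (Num.floor a).
  by move/eqP: b_eq0; rewrite subr_eq0 => /eqP.
rewrite /cis -[2 * pi * b]mulrA mulr_natl => /(congr1 (@complex.Re R)) /=.
rewrite cos_mulr2n => cosE.
suff : 0 < sin (pi * b).
  have := cos2Dsin2 (pi * b).
  move: cosE; rewrite -mulr_natl; nra.
apply: sin_gt0_pi; have := pi_gt0 R => pi0.
rewrite mulr_gt0 //=; last by rewrite lt_neqAle eq_sym b_neq0.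
by rewrite gtr_pMr.
Qed.

Lemma p_eq (R : realType) (a b : R) : (p a = p b) <-> (a - b \is a Num.int).
Proof.
rewrite -cis_eq1 cisD cisN; split.
  by move=> /(congr1 set_val) ab; rewrite (ab : cis a = cis b) divff// cis_neq0.
move=> h; apply/val_inj => /=.
by apply: (divIf (cis_neq0 b)); rewrite h divff// cis_neq0.
Qed.

Lemma p_surj (R : realType) (z : S1 R) : exists a : R, p a = z.
Proof.
have /set_mem /= := valP z; case zE : (val z) => [x y].
rewrite /S1 /= normc_def /= => /(congr1 (@complex.Re R)) /= xy1.
have {xy1} xy1 : x ^+ 2 + y ^+ 2 = 1.
  by rewrite -[LHS]sqr_sqrtr ?xy1 ?expr1n// addr_ge0// sqr_ge0.
have x1 : -1 <= x <= 1 by apply/andP; split; nra.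
have cosx : cos (acos x) = x by apply: acosK; rewrite in_itv.
have pi_neq0 : 2 * pi != 0 :> R by rewrite mulf_neq0// gt_eqF// pi_gt0.
have siny : sin (acos x) = `|y|.
  by rewrite sin_acos// -xy1 addrAC subrr add0r sqrtr_sqr.
case: (lerP 0 y) siny => [y0|y0] siny.
  exists (acos x / (2 * pi)); apply/val_inj; rewrite zE /= /cis.
  by rewrite [2 * pi * _]mulrC divfK// cosx siny ger0_norm.
exists (- acos x / (2 * pi)); apply/val_inj; rewrite zE /= /cis.
by rewrite [2 * pi * _]mulrC divfK// cosN sinN cosx siny ltr0_norm // opprK.
Qed.

Lemma cis_continuous (R : realType) : continuous (@cis R).
Proof.
move=> a; apply/cvgrPdist_lt => -[e ei]; rewrite ltcE /= => /andP[/eqP -> e0].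
have e2 : 0 < e / 2 by rewrite divr_gt0.
have c2 : {for a, continuous (fun t : R => 2 * pi * t)}.
  exact: mulrl_continuous.
have /cvgrPdist_lt/(_ _ e2) nc :
    {for a, continuous (fun t : R => cos (2 * pi * t))}.
  by apply: continuous_comp => //; exact: continuous_cos.
have /cvgrPdist_lt/(_ _ e2) ns :
    {for a, continuous (fun t : R => sin (2 * pi * t))}.
  by apply: continuous_comp => //; exact: continuous_sin.
near=> t; rewrite normc_def ltcR /=.
have h1 : `|cos (2 * pi * a) - cos (2 * pi * t)| < e / 2 by near: t.
have h2 : `|sin (2 * pi * a) - sin (2 * pi * t)| < e / 2 by near: t.
rewrite -[ltRHS](ger0_norm (ltW e0)) -sqrtr_sqr ltr_sqrt ?exprn_gt0//.
move: h1 h2; rewrite !ltr_norml => /andP[? ?] /andP[? ?].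
by nra.
Unshelve. all: by end_near. Qed.

(** The covering is an open map, in a form that produces a neighbourhood of p x
whose points lift close to x.  The complement of p (]x - e, x + e[) is the image
of the compact interval [x + e, x + 1 - e], hence closed. *)
Lemma p_open (R : realType) (x e : R) : 0 < e ->
  exists V : set (S1 R), [/\ open V, V (p x) &
    forall y, V (p y) -> exists z, p z = p y /\ `|x - z| < e].
Proof.
move=> e0; pose K : set R := `[x + e, x + 1 - e].
pose W := ~` (@cis R @` K).
have oW : open W.
  apply: closed_openC; apply: compact_closed; first exact: norm_hausdorff.
  apply: continuous_compact; last exact: segment_compact.
  by apply: continuous_subspaceT; exact: cis_continuous.
exists (set_val @^-1` W); split.
- by exists W.
- move=> [y]; rewrite /K /= in_itv /= => /andP[y1 y2] pyx.
  have /p_eq/intrP[k kE] : p y = p x by exact/val_inj.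
  have : 0 < (k%:~R : R) < 1 by rewrite -kE; apply/andP; split; lra.
  by rewrite ltr0z ltrz1 => /andP[k0]; rewrite ltNge -gtz0_ge1 k0.
- move=> y Wy; pose k := Num.floor (y - x).
  have k1 := ge_floor (y - x); have k2 := floorD1_gt (y - x).
  rewrite -/k ?intrD in k1 k2.
  have pk (l : int) : p (y - l%:~R) = p y.
    by apply/p_eq; rewrite addrAC subrr add0r rpredN intr_int.
  have notK z : p z = p y -> ~ K z.
    by move=> zy Kz; apply: Wy; exists z => //; exact: congr1 zy.
  (* The translate of y in [x, x + 1[ avoids K, so it is close to x, or its
     predecessor is. *)
  have [c1|c1] := ltP (y - k%:~R) (x + e).
    exists (y - k%:~R); split => //; rewrite ltr_norml; apply/andP; split; lra.
  have [c2|c2] := ltP (x + 1 - e) (y - k%:~R).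
    exists (y - (k + 1)%:~R); split => //; rewrite intrD ltr_norml.
    by apply/andP; split; lra.
  by case: (notK _ (pk k)); rewrite /K /= in_itv /= c1 c2.
Qed.

(** * Sets over an n-valued map *)

(** A set of n-element sets is open when the corresponding set of n-tuples is;
here it is a union of n cylinders. *)
Lemma open_meet (T : topologicalType) (n : nat) (V : set T) :
  open V -> open [set A : D T n | exists2 a, elements A a & V a].
Proof.
move=> oV.
rewrite /open /= /quotient_open.
have -> : \pi_(D T n)%qT @^-1` [set A | exists2 a, elements A a & V a] =
   set_val @^-1` [set x : {ptws 'I_n -> T} | exists i, V (x i)].
  rewrite eqEsubset; split => x /=; rewrite elements_pi.
    by move=> [_ [i _ <-] Vi]; exists i.
  by move=> [i Vi]; exists (set_val x i) => //; exists i.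
exists [set x : {ptws 'I_n -> T} | exists i, V (x i)] => //.
have -> : [set x : {ptws 'I_n -> T} | exists i, V (x i)] =
   \bigcup_(i : 'I_n) (proj i @^-1` V).
  by rewrite eqEsubset; split => [x [i Vi]|x [i _ Vi]]; exists i.
apply: bigcup_open => i _.
by apply: open_comp => // x _; exact: proj_continuous.
Qed.

Definition fiber (R : realType) (n : nat) (A : D (S1 R) n) : set R :=
  [set a | elements A (p a)].

Definition sparse (R : realType) (e : R) (A : set R) :=
  forall a b, A a -> A b -> `|a - b| < e -> a = b.

Definition approx_by (R : realType) (e : R) (A B : set R) :=
  forall a, A a -> exists2 b, B b & `|a - b| < e.

(** Half of the continuity of the fibers; the other half needs that they all
have the same number of points modulo the integers, see [fiber_near]. *)
Lemma fiber_lsc (R : realType) (n : nat) (X : topologicalType)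
    (f : X -> D (S1 R) n) (x : X) (a e : R) :
  {for x, continuous f} -> fiber (f x) a -> 0 < e ->
  \forall y \near x, exists2 b, fiber (f y) b & `|a - b| < e.
Proof.
move=> fx fa e0; have [V [oV Va Vp]] := p_open a e0.
have : \forall y \near x, exists2 w, elements (f y) w & V w.
  apply: (fx [set A : D (S1 R) n | exists2 w, elements A w & V w]).
  by apply: open_nbhs_nbhs; split; [exact: open_meet | exists (p a)].
apply: filterS => y [w fw Vw]; have [b bw] := p_surj w.
rewrite -bw in fw Vw; have [c [cb ac]] := Vp _ Vw.
by exists c => //; rewrite /fiber /= cb.
Qed.

Lemma fiber_representatives (R : realType) (n : nat) (A : D (S1 R) n) :
  exists x : 'I_n -> R, (forall i j, x i - x j \is a Num.int -> i = j) /\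
    forall a, fiber A a <-> exists i (k : int), a = x i + k%:~R.
Proof.
have [y yA] := conf_to_nsubset_surj (A : nsubset (S1 R) n).
have [x xy] := choice (fun i => p_surj (set_val y i)).
exists x; split=> [i j /p_eq|a].
  by rewrite !xy; exact: (set_mem (valP y)).
have -> : fiber A a = range (set_val y : 'I_n -> S1 R) (p a).
  by rewrite /fiber /elements -yA.
split=> [[i _]|[i [k ->]]].
  rewrite -xy => /esym/p_eq/intrP[k kE]; exists i, k.
  by rewrite -kE addrC subrK.
exists i => //; rewrite -xy; apply/p_eq.
by rewrite opprD addrA subrr add0r rpredN intr_int.
Qed.

Lemma fiber_addz (R : realType) (n : nat) (A : D (S1 R) n) (a : R) (k : int) :
  fiber A a -> fiber A (a + k%:~R).
Proof.
rewrite /fiber /= (_ : p (a + k%:~R) = p a)//.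
by apply/p_eq; rewrite addrAC subrr add0r intr_int.
Qed.

(** The least nonzero value of |r + k| is governed by the fractional part of
r. *)
Lemma translates_gap (R : realType) (r : R) :
  exists2 e : R, 0 < e & forall k : int, `|r + k%:~R| < e -> r + k%:~R = 0.
Proof.
pose q := r - (Num.floor r)%:~R.
have q0 : 0 <= q by rewrite subr_ge0 ge_floor.
have q1 : q < 1 by rewrite ltrBlDl; have := floorD1_gt r; rewrite intrD.
have rk k : r + k%:~R = q + (k + Num.floor r)%:~R by rewrite /q intrD; ring.
have [q_eq0|q_neq0] := eqVneq q 0.
  exists 1 => // k; rewrite rk q_eq0 add0r => h.
  apply/eqP; apply: contraTT h => k0.
  by rewrite -leNgt norm_intr_ge1// intr_int.
have qgt0 : 0 < q by rewrite lt_neqAle eq_sym q_neq0.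
exists (Num.min q (1 - q)) => [|k].
  by rewrite lt_min qgt0 subr_gt0.
rewrite rk; set l := (k + _)%R; rewrite lt_min => /andP[].
have [l0|l0] := leP 0 l.
  have : 0 <= (l%:~R : R) by rewrite ler0z.
  by move=> ? h _; move: h; rewrite ger0_norm; lra.
have : (l%:~R : R) <= - 1.
  by rewrite -[leRHS]/((- 1)%:~R) ler_int; lia.
by move=> ? _; rewrite ltr0_norm; lra.
Qed.

Lemma fiber_sparse (R : realType) (n : nat) (A : D (S1 R) n) :
  exists2 e : R, 0 < e & sparse e (fiber A).
Proof.
have [x [xI xA]] := fiber_representatives A.
have [e] : exists e : R, 0 < e /\ forall (ij : 'I_n * 'I_n) (k : int),
    `|x ij.1 - x ij.2 + k%:~R| < e -> x ij.1 - x ij.2 + k%:~R = 0.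
  apply: (@filter_ex _ (0^'+)).
  near=> e; split; first by near: e; exact: nbhs_right_gt.
  near: e; apply: filter_forall => -[i j] /=.
  have [e e0 eP] := translates_gap (x i - x j).
  near=> e' => k ke; apply: eP; apply: lt_le_trans ke _.
  by near: e'; exact: nbhs_right_le.
move=> [e0 eP]; exists e => // a b /xA[i [k ->]] /xA[j [l ->]] ab.
have E : x i + k%:~R - (x j + l%:~R) = x i - x j + (k - l)%:~R.
  by rewrite intrB; ring.
by apply/eqP; rewrite -subr_eq0 E (eP (i, j))// -E.
Unshelve. all: by end_near. Qed.

(** Near x, each of the n points of the fiber over f x modulo the integers has
a close point in the fiber over f y.  These n points remain distinct modulo the
integers, hence represent the whole fiber over f y; the gap and the reverse
approximation are then read off from the fiber over f x. *)
Lemma fiber_near (R : realType) (n : nat) (X : topologicalType)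
    (f : X -> D (S1 R) n) (x : X) : {for x, continuous f} ->
  exists2 d : R, 0 < d & forall e, 0 < e -> \forall y \near x,
    [/\ sparse d (fiber (f y)), approx_by e (fiber (f x)) (fiber (f y))
      & approx_by e (fiber (f y)) (fiber (f x))].
Proof.
move=> fx; have [d d0 dP] := fiber_sparse (f x).
have [r [rI rP]] := fiber_representatives (f x).
have rf i k : fiber (f x) (r i + k%:~R) by apply/rP; exists i, k.
exists (d / 2); first by rewrite divr_gt0.
move=> e e0; pose e' := Num.min e (d / 4).
have e'0 : 0 < e' by rewrite lt_min e0 divr_gt0.
have : \forall y \near x, forall i, exists2 b, fiber (f y) b & `|r i - b| < e'.
  apply: filter_forall => i; apply: fiber_lsc => //.
  by apply/rP; exists i, 0; rewrite addr0.
apply: filterS => y near_r.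
have /choice[b bP] i : exists b, fiber (f y) b /\ `|r i - b| < e'.
  by have [b] := near_r i; exists b.
have rb i k : `|r i + k%:~R - (b i + k%:~R)| < e'.
  by rewrite opprD addrACA subrr addr0; exact: (bP i).2.
have e'd : e' <= d / 4 by rewrite ge_min lexx orbT.
have rb_eq i j k l : `|b i + k%:~R - (b j + l%:~R)| < d / 2 ->
    r i + k%:~R = r j + l%:~R.
  move=> h; apply: dP => //; move: h (rb i k) (rb j l) e'd.
  by rewrite !ltr_norml => /andP[? ?] /andP[? ?] /andP[? ?] ?; lra.
have r_eq i j k l : r i + k%:~R = r j + l%:~R -> i = j.
  move=> h; apply: rI; rewrite (_ : r i - r j = (l - k)%:~R) ?intr_int//.
  by rewrite intrB; lra.
(* The b i are distinct modulo the integers, hence by counting represent the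
   whole fiber. *)
have bf a : fiber (f y) a -> exists i (k : int), a = b i + k%:~R.
  have [z [zI zP]] := fiber_representatives (f y).
  have /choice[s sP] i : exists j, exists k : int, b i = z j + k%:~R.
    by have /zP := (bP i).1.
  have sI : injective s.
    move=> i j sij; have [k ki] := sP i; have [l lj] := sP j.
    apply: (@r_eq i j (- k) (- l)); apply: rb_eq.
    by rewrite ki lj sij !intrN !addrK subrr normr0 divr_gt0.
  have [s' _ s'K] := injF_bij sI.
  move=> /zP[j [k ->]]; have [l lE] := sP (s' j).
  by exists (s' j), (k - l); rewrite lE s'K intrB; ring.
have e'e : e' <= e by rewrite ge_min lexx.
split.
- move=> _ _ /bf[i [k ->]] /bf[j [l ->]] /rb_eq h.
  by have ij := r_eq _ _ _ _ h; rewrite ij in h *; move/addrI: h => ->.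
- move=> _ /rP[i [k ->]]; exists (b i + k%:~R).
    exact/fiber_addz/(bP i).1.
  exact: lt_le_trans (rb i k) e'e.
- move=> _ /bf[i [k ->]]; exists (r i + k%:~R) => //.
  by rewrite distrC; exact: lt_le_trans (rb i k) e'e.
Qed.

(** * Continuous enumerations and their transport *)

(** The last field says that E has degree d. *)
Record enumeration (R : realType) (n : nat) (d : int) (G : R -> set R)
    (E : int -> R -> R) : Prop := Enumeration {
  enum_continuous : forall m, continuous (E m);
  enum_lt : forall t m m', m < m' -> E m t < E m' t;
  enum_range : forall t a, G t a <-> exists m, a = E m t;
  enum_addn : forall m t, E (m + n%:Z) t = E m t + 1;
  enum_add1 : forall m t, E m (t + 1) = E (m + d) t }.

(** Transport of an enumeration to a nearby family of sets: E' m t is the point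
of G' t at distance less than e from E m t.  It is unique, since the points of
G' t are at least 4 e apart, and every relation between values of E is inherited
by this uniqueness.  The constant 4 comes from the continuity of E': the point b of
G' u found near E' m t is joined to E' m u, through E' m t, E m t and E m u, by
four steps shorter than e, hence b = E' m u. *)
Lemma enumeration_near (R : realType) (n : nat) (d : int) (G G' : R -> set R)
    (E : int -> R -> R) (e : R) :
  enumeration n d G E ->
  (forall t a, G' t a -> G' t (a + 1)) ->
  (forall t, G' (t + 1) = G' t) ->
  (forall t a r, G' t a -> 0 < r ->
    \forall u \near t, exists2 b, G' u b & `|a - b| < r) ->
  0 < e ->
  (forall t, sparse (4 * e) (G t)) -> (forall t, sparse (4 * e) (G' t)) ->
  (forall t, approx_by e (G t) (G' t)) ->
  (forall t, approx_by e (G' t) (G t)) ->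
  exists E', enumeration n d G' E'.
Proof.
move=> [Ec Elt EG En E1] G'1 G'p G'lsc e0 sepG sepG' GG' G'G.
have GE m t : G t (E m t) by apply/EG; exists m.
have /choice[E' E'P] (mt : int * R) :
    exists b, G' mt.2 b /\ `|E mt.1 mt.2 - b| < e.
  by have [b] := GG' mt.2 _ (GE mt.1 mt.2); exists b.
have E'G m t : G' t (E' (m, t)) := (E'P (m, t)).1.
have EE' m t : `|E m t - E' (m, t)| < e := (E'P (m, t)).2.
have E'uniq m t b : G' t b -> `|E m t - b| < e -> b = E' (m, t).
  move=> tb Eb; apply: (sepG' t) => //; move: Eb (EE' m t).
  by rewrite !ltr_norml => /andP[? ?] /andP[? ?]; apply/andP; split; lra.
exists (fun m t => E' (m, t)); split.
- move=> m t; apply/cvgrPdist_lt => r r0.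
  have r'0 : 0 < Num.min r e by rewrite lt_min r0.
  have /cvgrPdist_lt/(_ _ e0) Emt : {for t, continuous (E m)} by exact: Ec.
  have := G'lsc _ _ _ (E'G m t) r'0; apply: filterS2 Emt => u Etu [b ub].
  rewrite lt_min => /andP[br be].
  rewrite (_ : E' (m, u) = b)//; apply: (sepG' u) => //.
  move: Etu be (EE' m t) (EE' m u).
  rewrite !ltr_norml => /andP[? ?] /andP[? ?] /andP[? ?] /andP[? ?].
  by apply/andP; split; lra.
- move=> t m m' mm'; have lt := Elt t _ _ mm'.
  have : 4 * e <= E m' t - E m t.
    rewrite leNgt; apply/negP => h; have := sepG t _ _ (GE m' t) (GE m t).
    by rewrite gtr0_norm ?subr_gt0// => /(_ h) eq; rewrite eq ltxx in lt.
  move: (EE' m t) (EE' m' t).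
  by rewrite !ltr_norml => /andP[? ?] /andP[? ?] ?; lra.
- move=> t a; split=> [ta|[m ->]]; last exact: E'G.
  have [_ /EG[m ->] ab] := G'G _ _ ta.
  by exists m; apply: E'uniq => //; rewrite distrC.
- move=> m t; apply/esym/E'uniq; first exact/G'1/E'G.
  by rewrite En opprD addrACA subrr addr0; exact: EE'.
- move=> m t; apply: E'uniq; first by rewrite -G'p; exact: E'G.
  by rewrite -E1; exact: EE'.
Qed.

(** Precomposing with the retraction onto [0, 1] turns a homotopy into a map
that is continuous on the whole plane. *)
Definition clamp (R : realType) (s : R) := Num.max 0 (Num.min s 1).

Lemma clamp_dist (R : realType) (s t : R) : `|clamp s - clamp t| <= `|s - t|.
Proof.
wlog st : s t / s <= t => [h|].
  have /orP[/h//|/h] := le_total s t.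
  by rewrite distrC [leRHS]distrC.
rewrite [leRHS]distrC [leRHS]ger0_norm ?subr_ge0// ler_norml /clamp.
case: (leP s 1) => s1; case: (leP t 1) => t1; rewrite ?(max_r ler01);
  try case: (leP 0 s) => s0; try case: (leP 0 t) => t0;
  by apply/andP; split; lra.
Qed.

Lemma clamp01 (R : realType) (s : R) : 0 <= clamp s <= 1.
Proof. by rewrite le_max lexx ge_max ler01 ge_min lexx orbT. Qed.

Lemma clamp_id (R : realType) (s : R) : 0 <= s <= 1 -> clamp s = s.
Proof. by move=> /andP[s0 s1]; rewrite /clamp min_l// max_r. Qed.

Lemma clamp_continuous (R : realType) : continuous (@clamp R).
Proof.
move=> s; apply/cvgrPdist_lt => e e0; near=> t.
apply: le_lt_trans (clamp_dist _ _) _.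
near: t; exact: (@cvgr_dist_lt _ _ _ (nbhs s) _ id).
Unshelve. all: by end_near. Qed.

Lemma p_continuous (R : realType) : continuous (@p R).
Proof.
move=> t U [_ [[W oW <-] Wt WU]].
apply: (@filterS _ (nbhs t) _ (@cis R @^-1` W)).
  by move=> s Ws; apply: WU; exact: Ws.
by apply: (@cis_continuous R t W); exact: open_nbhs_nbhs.
Qed.

Lemma p_addz (R : realType) (t : R) (k : int) : p (t + k%:~R) = p t.
Proof. by apply/p_eq; rewrite addrAC subrr add0r intr_int. Qed.

Lemma clamped_continuous (R : realType) (Y : topologicalType)
    (H : S1 R * R -> Y) :
  {within [set: S1 R] `*` `[0, 1], continuous H} ->
  continuous (fun u : R * R => H (p u.1, clamp u.2)).
Proof.
move=> Hc u U HU.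
have in01 (v : R * R) : ([set: S1 R] `*` `[0, 1]) (p v.1, clamp v.2).
  by split => //=; rewrite in_itv /= clamp01.
have HW : within ([set: S1 R] `*` `[0, 1])
    (nbhs (p u.1, clamp u.2)) (H @^-1` U).
  by rewrite nbhs_subspace_in//; exact: Hc.
have pc : {for u, continuous (fun v : R * R => (p v.1, clamp v.2))}.
  have p1 : {for u, continuous (fun v : R * R => p v.1)}.
    by apply: (@cvg_comp _ _ _ fst (@p R) _ (nbhs u.1));
      [exact: cvg_fst | exact: p_continuous].
  have p2 : {for u, continuous (fun v : R * R => clamp v.2)}.
    by apply: (@cvg_comp _ _ _ snd (@clamp R) _ (nbhs u.2));
      [exact: cvg_snd | exact: clamp_continuous].
  exact: (cvg_pair p1 p2).
have := pc _ HW.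
have {}HW : \forall v \near u, ([set: S1 R] `*` `[0, 1]) (p v.1, clamp v.2) ->
    (H @^-1` U) (p v.1, clamp v.2) by exact: pc _ HW.
suff : \forall v \near u, U (H (p v.1, clamp v.2)) by [].
by apply: filterS HW => v; apply; exact: in01.
Qed.


Lemma fiber_sparse_uniform (R : realType) (n : nat) (X : topologicalType)
    (f : X -> D (S1 R) n) (K : set X) : continuous f -> compact K ->
  exists2 e : R, 0 < e & forall x, K x -> sparse e (fiber (f x)).
Proof.
move=> fc /compact_near_coveringP cK.
have [e [e0 eK]] : exists e : R, 0 < e /\
    K `<=` (fun x => sparse e (fiber (f x))).
  apply: (@filter_ex _ (0^'+)); near=> e; split.
    by near: e; exact: nbhs_right_gt.
  near: e; apply: (cK _ _ (fun e x => sparse e (fiber (f x)))) => x Kx.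
  have [d d0 /(_ 1 ltr01) dP] := fiber_near (fc x).
  near=> y e => a b /= ya yb ab.
  have ed : e <= d by near: e; exact: nbhs_right_le.
  have [sp _ _] : [/\ sparse d (fiber (f y)),
      approx_by 1 (fiber (f x)) (fiber (f y))
    & approx_by 1 (fiber (f y)) (fiber (f x))] by near: y.
  by apply: sp => //; apply: lt_le_trans ab _.
by exists e.
Unshelve. all: by end_near. Qed.

Lemma approx_by_trans (R : realType) (d e : R) (A B C : set R) :
  approx_by d A B -> approx_by e B C -> approx_by (d + e) A C.
Proof.
move=> AB BC a /AB[b /BC[c Cc bc] ab]; exists c => //.
rewrite (_ : a - c = (a - b) + (b - c)); last by rewrite addrA subrK.
by apply: le_lt_trans (ler_normD _ _) _; exact: ltrD.
Qed.

Lemma fiber_near_uniform (R : realType) (n : nat)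
    (f : R * R -> D (S1 R) n) (K : set (R * R)) (e : R) :
  continuous f -> compact K -> 0 < e ->
  exists2 h : R, 0 < h & forall t s s', K (t, s) -> `|s - s'| < h ->
    approx_by e (fiber (f (t, s))) (fiber (f (t, s'))) /\
    approx_by e (fiber (f (t, s'))) (fiber (f (t, s))).
Proof.
move=> fc /compact_near_coveringP cK e0.
have e2 : 0 < e / 2 by rewrite divr_gt0.
have [h [h0 hK]] : exists h : R, 0 < h /\
    K `<=` (fun u => forall s', `|u.2 - s'| < h ->
      approx_by e (fiber (f u)) (fiber (f (u.1, s'))) /\
      approx_by e (fiber (f (u.1, s'))) (fiber (f u))).
  apply: (@filter_ex _ (0^'+)); near=> h; split.
    by near: h; exact: nbhs_right_gt.
  near: h; apply: (cK _ _ (fun h u => forall s', `|u.2 - s'| < h ->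
      approx_by e (fiber (f u)) (fiber (f (u.1, s'))) /\
      approx_by e (fiber (f (u.1, s'))) (fiber (f u)))) => u Ku.
  have [d d0 /(_ _ e2) /nbhs_ballP[r /= r0 rP]] := fiber_near (fc u).
  have r2 : 0 < r / 2 by rewrite divr_gt0.
  near=> v h => s' vs'.
  have [v1 v2] : ball u (r / 2) v by near: v; exact: nbhsx_ballx.
  have hr : h <= r / 2 by near: h; exact: nbhs_right_le.
  have [_ uv vu] : [/\ sparse d (fiber (f v)),
      approx_by (e / 2) (fiber (f u)) (fiber (f v))
    & approx_by (e / 2) (fiber (f v)) (fiber (f u))].
    by apply: rP; split; apply: le_ball (_ : r / 2 <= r) _ _ => //; lra.
  have [_ us su] : [/\ sparse d (fiber (f (v.1, s'))),
      approx_by (e / 2) (fiber (f u)) (fiber (f (v.1, s')))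
    & approx_by (e / 2) (fiber (f (v.1, s'))) (fiber (f u))].
    apply: rP; split; first by apply: le_ball v1; lra.
    move: v2; rewrite /ball /= /ball_ /= => v2.
    have := ltrD v2 (lt_le_trans vs' hr); rewrite -splitr.
    apply: le_lt_trans; apply: le_trans (ler_normD _ _).
    by rewrite addrA subrK.
  by rewrite (splitr e); split; apply: approx_by_trans; eassumption.
by exists h => // t s s' /hK; exact.
Unshelve. all: by end_near. Qed.

(** By periodicity in t and clamping in s, the gap and the modulus of continuity
in s found on the unit square are valid on the plane.  An enumeration is then
carried from s = 1 to s = 0 by finitely many steps. *)
Lemma enumeration_clamp (R : realType) (n : nat) (d : int)
    (f : R * R -> D (S1 R) n) :
  continuous f -> (forall t (k : int) s, f (t + k%:~R, s) = f (t, s)) ->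
  (forall t s, f (t, clamp s) = f (t, s)) ->
  (exists E, enumeration n d (fun t => fiber (f (t, 1))) E) ->
  exists E, enumeration n d (fun t => fiber (f (t, 0))) E.
Proof.
move=> fc fper fclamp enum1.
pose K : set (R * R) := `[0, 1] `*` `[0, 1].
have cK : compact K by apply: compact_setX; exact: segment_compact.
have red t s : exists2 t', K (t', clamp s) & forall s', f (t, s') = f (t', s').
  exists (t - (Num.floor t)%:~R) => [|s']; last by rewrite -mulrNz fper.
  split; rewrite /= in_itv /= ?clamp01//.
  rewrite subr_ge0 ge_floor /= lerBlDl ltW//.
  by have := floorD1_gt t; rewrite intrD.
have [g g0 gP] := fiber_sparse_uniform fc cK.
pose e := g / 4.
have e0 : 0 < e by rewrite divr_gt0.
have sp t s : sparse (4 * e) (fiber (f (t, s))).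
  have [t' Kt' ->] := red t s.
  by rewrite /e mulrC divfK// -fclamp; exact: gP.
have [h h0 hP] := fiber_near_uniform fc cK e0.
have close t s s' : `|s - s'| < h ->
    approx_by e (fiber (f (t, s))) (fiber (f (t, s'))) /\
    approx_by e (fiber (f (t, s'))) (fiber (f (t, s))).
  move=> ss'; have [t' Kt' E] := red t s.
  rewrite !E -(fclamp t' s) -(fclamp t' s'); apply: hP => //.
  exact: le_lt_trans (clamp_dist _ _) ss'.
have step s s' : `|s - s'| < h ->
    (exists E, enumeration n d (fun t => fiber (f (t, s))) E) ->
    exists E, enumeration n d (fun t => fiber (f (t, s'))) E.
  move=> ss' [E eE]; apply: (enumeration_near eE _ _ _ e0) => //.
  - by move=> t a; exact: (@fiber_addz _ _ _ a 1).
  - by move=> t; rewrite (fper t 1).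
  - move=> t a r ta r0; apply: (@fiber_lsc _ _ _ (fun u => f (u, s'))) => //.
    have pc : {for t, continuous (fun u : R => (u, s'))}.
      exact: (@cvg_pair _ _ _ (nbhs t) (nbhs t) (nbhs s') _ _ _
        id (fun=> s') cvg_id (cvg_cst s')).
    exact: (@continuous_comp _ _ _ (fun u : R => (u, s')) f _ pc (fc _)).
  - by move=> t; have [] := close t s s' ss'.
  - by move=> t; have [] := close t s s' ss'.
have iter (k : nat) :
    exists E, enumeration n d (fun t => fiber (f (t, 1 - k%:R * (h / 2)))) E.
  elim: k => [|k]; first by rewrite mul0r subr0.
  apply: step; rewrite -natr1 (_ : _ - _ = h / 2); last by ring.
  by rewrite gtr0_norm; lra.
have [k] := iter (Num.truncn (2 / h)).+1.
move=> eE; exists k; move: eE; congr (enumeration n d _ k).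
apply/funext => t; congr fiber; rewrite -fclamp; congr (f (t, _)).
have := truncnS_gt (2 / h); rewrite ltr_pdivrMr// => kh.
by rewrite /clamp max_l// ge_min; apply/orP; left; lra.
Qed.

(** Here n a - d t is an integer exactly when a lies over an n-th root of
p t ^ d. *)
Lemma enumeration_phi (R : realType) (n : nat) (n_gt0 : (0 < n)%N) (d : int) :
  enumeration n d (fun t : R => fiber (phi n_gt0 d (p t)))
    (fun m t => (d%:~R * t + m%:~R) / n%:R).
Proof.
have n0 : 0 < n%:R :> R by rewrite ltr0n.
have nn0 : n%:R != 0 :> R by rewrite gt_eqF.
split.
- move=> m t; apply: cvgM; last exact: cvg_cst.
  by apply: cvgD; [exact: mulrl_continuous | exact: cvg_cst].
- by move=> t m m' mm'; rewrite ltr_pM2r ?invr_gt0// ltrD2l ltr_int.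
- move=> t a.
  have -> : fiber (phi n_gt0 d (p t)) a <-> cis a ^+ n = cis t ^ d by [].
  rewrite -cis_natmul -cis_intmul.
  have -> : cis (n%:R * a) = cis (d%:~R * t) <-> p (n%:R * a) = p (d%:~R * t).
    by split=> [h|/(congr1 set_val)//]; exact/val_inj.
  split=> [/p_eq/intrP[m mE]|[m ->]].
    by exists m; rewrite -mE addrC subrK mulrC mulKf.
  by apply/p_eq; rewrite mulrC divfK// addrAC subrr add0r intr_int.
- by move=> m t; rewrite intrD addrA mulrDl [_%:~R / _]divff.
- by move=> m t; rewrite intrD mulrDr mulr1 addrAC addrA.
Qed.

Lemma has_degree_enumeration (R : realType) (n : nat) (n_gt0 : (0 < n)%N)
    (f : S1 R -> D (S1 R) n) (d : int) :
  has_degree n_gt0 f d ->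
  exists E, enumeration n d (fun t => fiber (f (p t))) E.
Proof.
move=> [H [Hc H0 H1]].
pose h (u : R * R) := H (p u.1, clamp u.2).
have c0 : clamp 0 = 0 :> R by rewrite clamp_id// lexx ler01.
have c1 : clamp 1 = 1 :> R by rewrite clamp_id// lexx ler01.
have -> : (fun t => fiber (f (p t))) = (fun t => fiber (h (t, 0))).
  by apply/funext => t; rewrite /h /= c0 H0.
apply: enumeration_clamp; first exact: clamped_continuous.
- by move=> t k s; rewrite /h /= p_addz.
- by move=> t s; rewrite /h /= (clamp_id (clamp01 s)).
exists (fun m t => (d%:~R * t + m%:~R) / n%:R).
have -> : (fun t => fiber (h (t, 1))) = (fun t => fiber (phi n_gt0 d (p t))).
  by apply/funext => t; rewrite /h /= c1 H1.
exact: enumeration_phi.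
Qed.

(** * The lift-factors *)

Lemma enum_inj (R : realType) (n : nat) (d : int) (G : R -> set R)
    (E : int -> R -> R) (t : R) :
  enumeration n d G E -> injective (E^~ t).
Proof.
move=> eE m m' /= mm'; case: (ltgtP m m') => // /(enum_lt eE t).
  by rewrite mm' ltxx.
by rewrite mm' ltxx.
Qed.

Lemma enum_le (R : realType) (n : nat) (d : int) (G : R -> set R)
    (E : int -> R -> R) (m m' : int) (t : R) :
  enumeration n d G E -> (E m t <= E m' t) = (m <= m').
Proof.
move=> eE; case: (ltgtP m m') => [/(enum_lt eE t)/ltW//|/(enum_lt eE t)|->].
  by rewrite ltNge => /negbTE.
by rewrite lexx.
Qed.

Lemma enum_addz (R : realType) (n : nat) (d : int) (G : R -> set R)
    (E : int -> R -> R) (k m : int) (t : R) :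
  enumeration n d G E -> E (m + k * n%:Z) t = E m t + k%:~R.
Proof.
move=> eE.
have nat_case (j : nat) q : E (q + j%:Z * n%:Z) t = E q t + j%:R.
  elim: j => [|j IH]; first by rewrite mul0r !addr0.
  rewrite (_ : q + _ = q + j%:Z * n%:Z + n%:Z); last by rewrite intS; ring.
  by rewrite (enum_addn eE) IH -natr1 addrA.
case: k => j; first exact: nat_case.
have := nat_case j.+1 (m - j.+1%:Z * n%:Z); rewrite subrK => ->.
by rewrite NegzE mulNr intrN addrK.
Qed.

Lemma enum_shift (R : realType) (n : nat) (d : int) (G : R -> set R)
    (E : int -> R -> R) (k m : int) (t : R) :
  enumeration n d G E -> E m (t + k%:~R) = E (m + k * d) t.
Proof.
move=> eE.
have nat_case (j : nat) q u : E q (u + j%:R) = E (q + j%:Z * d) u.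
  elim: j q => [|j IH] q; first by rewrite mul0r !addr0.
  rewrite -natr1 addrA (enum_add1 eE) IH; congr (E _ u).
  by rewrite intS; ring.
case: k => j; first exact: nat_case.
have := nat_case j.+1 (m - j.+1%:Z * d) (t - j.+1%:R).
by rewrite !subrK NegzE mulNr intrN.
Qed.

(** The midpoint between E m and E (m + 1) is never a point of G, so g cannot
cross it. *)
Lemma enum_le_path (R : realType) (n : nat) (d : int) (G : R -> set R)
    (E : int -> R -> R) (g : R -> R) (m : int) (a b : R) :
  enumeration n d G E -> continuous g -> (forall t, G t (g t)) ->
  g a <= E m a -> g b <= E m b.
Proof.
move=> eE gc gG ga; rewrite leNgt; apply/negP => gb.
pose mid t := (E m t + E (m + 1) t) / 2.
have Elt t : E m t < E (m + 1) t by apply: (enum_lt eE); rewrite ltrDl.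
have midc : continuous mid.
  move=> t; apply: cvgM; last exact: cvg_cst.
  by apply: cvgD; exact: (enum_continuous eE).
have gmid c : g c <> mid c.
  have [q qc] := (enum_range eE c (g c)).1 (gG c); rewrite /mid qc => cE.
  have := Elt c; have [qm|mq] := leP q m.
    by move: qm; rewrite -(enum_le q m c eE); lra.
  by move: mq; rewrite -lezD1 -(enum_le (m + 1) q c eE); lra.
have hc : continuous (fun t => g t - mid t).
  by move=> t; apply: cvgB; [exact: gc | exact: midc].
have ha : g a - mid a < 0 by rewrite /mid; have := Elt a; lra.
have hb : 0 < g b - mid b.
  have [q qb] := (enum_range eE b (g b)).1 (gG b).
  move: gb; rewrite qb ltNge (enum_le q m b eE) -ltNge -lezD1.
  by rewrite -(enum_le (m + 1) q b eE) /mid; have := Elt b; lra.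
have zero x y : x <= y ->
    Num.min (g x - mid x) (g y - mid y) <= 0
      <= Num.max (g x - mid x) (g y - mid y) -> False.
  move=> xy xy0; have [c _ /eqP] := IVT xy (continuous_subspaceT hc) xy0.
  by rewrite subr_eq0 => /eqP; exact: gmid.
have [ab|ba] := leP a b.
  by apply: (zero a b ab); rewrite ge_min le_max (ltW ha) (ltW hb) orbT.
by apply: (zero b a (ltW ba)); rewrite ge_min le_max (ltW ha) (ltW hb) orbT.
Qed.

Lemma enum_path (R : realType) (n : nat) (d : int) (G : R -> set R)
    (E : int -> R -> R) (g : R -> R) :
  enumeration n d G E -> continuous g -> (forall t, G t (g t)) ->
  exists m, g = E m.
Proof.
move=> eE gc gG; have [m m0] := (enum_range eE 0 (g 0)).1 (gG 0).
exists m; apply/funext => t.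
have gle : g t <= E m t.
  by apply: (@enum_le_path _ _ _ _ _ g m 0 t eE gc gG); rewrite m0.
have [q qt] := (enum_range eE t (g t)).1 (gG t).
have [qm|mq|<-//] := ltgtP q m.
  have : g 0 <= E q 0.
    by apply: (@enum_le_path _ _ _ _ _ g q t 0 eE gc gG); rewrite qt.
  by rewrite m0 => /le_lt_trans/(_ (enum_lt eE 0 qm)); rewrite ltxx.
by have := enum_lt eE t mq; rewrite -qt ltNge gle.
Qed.

(** Conversely, E m is a coordinate of the lifting
(E m, E (m + 1), ..., E (m + n - 1)). *)
Lemma lift_factorP (R : realType) (n : nat) (n_gt0 : (0 < n)%N) (d : int)
    (f : S1 R -> D (S1 R) n) (E : int -> R -> R) :
  enumeration n d (fun t => fiber (f (p t))) E ->
  forall g, lift_factor f g <-> exists m, g = E m.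
Proof.
move=> eE g; split=> [[fb [i [[fbc fbf] ->]]]|[m ->]].
  apply: (enum_path eE); last by move=> t; rewrite /fiber /= fbf; exists i.
  move=> t; apply: (@continuous_comp _ _ _ (fun t => set_val (fb t))
    (fun x : {ptws 'I_n -> R} => x i)); last first.
    exact: (@proj_continuous _ (fun=> R) i).
  by apply: continuous_comp; [exact: fbc | exact: initial_continuous].
have eqz (i j : 'I_n) k t : E (m + i%:Z) t - E (m + j%:Z) t = k%:~R -> i = j.
  move=> /eqP; rewrite subr_eq (addrC k%:~R) -(enum_addz _ _ _ eE).
  move=> /eqP/(enum_inj eE) ij; apply: val_inj => /=.
  have := ltn_ord i; have := ltn_ord j => jn iN.
  have kn : k * n%:Z = i%:Z - j%:Z by lia.
  have n0 : 0 < n%:Z by rewrite ltz_nat.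
  have k1 : k < 1 by rewrite -(ltr_pM2r n0) kn; lia.
  have k2 : - 1 < k by rewrite -(ltr_pM2r n0) kn; lia.
  have k0 : k = 0 by lia.
  by move: kn; rewrite k0; lia.
have conf_E t : (fun i : 'I_n => E (m + i%:Z) t) \in confZ R n.
  apply/mem_set => i j /eqP ij; apply/negP => /intrP[k] /eqz; exact: ij.
pose fb t : confZ R n :=
  exist (fun x => x \in confZ R n) _ (conf_E t).
exists fb, (Ordinal n_gt0); split; last first.
  by apply/funext => t; rewrite -[in LHS](addr0 m).
split=> [|t].
  apply: continuous_comp_initial => t; apply/cvg_sup => i.
  apply: (@continuous_comp_initial _ _ _ (fun x : 'I_n -> R => x i)
    (fun t (i : 'I_n) => E (m + i%:Z) t)).
  exact: (enum_continuous eE).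
rewrite eqEsubset; split=> [w fw|_ [i _ <-]]; last first.
  suff : fiber (f (p t)) (E (m + i%:Z) t) by [].
  by apply/(enum_range eE); exists (m + i%:Z).
have [a aw] := p_surj w; rewrite -aw in fw *.
have [q ->] := (enum_range eE t a).1 fw.
have n0 : (n%:Z != 0 :> int) by rewrite eqz_nat -lt0n.
have rE : ((q - m) %% n%:Z)%Z = `|((q - m) %% n%:Z)%Z|%N%:Z.
  by rewrite gez0_abs// modz_ge0.
have rn : (`|((q - m) %% n%:Z)%Z| < n)%N.
  by rewrite -ltz_nat -rE ltz_pmod// ltz_nat.
exists (Ordinal rn) => //.
have -> : set_val (fb t) (Ordinal rn) = E (m + ((q - m) %% n%:Z)%Z) t.
  by rewrite [in RHS]rE.
have {2}-> : q = m + ((q - m) %% n%:Z)%Z + ((q - m) %/ n%:Z)%Z * n%:Z.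
  by rewrite -addrA [_ + _ * _]addrC -divz_eq addrC subrK.
by rewrite (enum_addz _ _ _ eE) p_addz.
Qed.

(** Translating by k in the target adds k n to the index, and translating by -k
in the source subtracts k d. *)
Lemma lift_factor_equivP (R : realType) (n : nat) (d : int) (G : R -> set R)
    (E : int -> R -> R) (m m' : int) :
  enumeration n d G E ->
  lift_factor_equiv (E m) (E m') <-> exists k : int, m = m' + k * (n%:Z - d).
Proof.
move=> eE.
have shift (k : int) t : k%:~R + E m' (t - k%:~R) = E (m' + k * (n%:Z - d)) t.
  rewrite -intrN (enum_shift _ _ _ eE) addrC -(enum_addz _ _ _ eE).
  by congr (E _ t); ring.
split=> -[k kE]; exists k.
  by apply: (enum_inj (t := 0) eE); rewrite kE shift.
by move=> t; rewrite shift kE.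
Qed.

Lemma counting_card (R : realType) (T : choiceType) (A : set T) (N : nat) :
  (A #= `I_N)%card -> counting A = (N%:R)%:E :> \bar R.
Proof.
move=> AN; rewrite /counting asboolT; first by rewrite (card_fset_set AN).
by exists N.
Qed.

Theorem theorem5p1 (R : realType) (n : nat) (n_gt0 : (0 < n)%N)
  (f : S1 R -> D (S1 R) n) (f_continuous : continuous f)
  (d : int) (f_degree : has_degree n_gt0 f d) (d_neq_n : d <> n%:Z) :
  reidemeister_number f = (`|d - n%:Z|%:~R)%:E.
Proof.
have [E eE] := has_degree_enumeration f_degree.
have lfP := lift_factorP n_gt0 eE.
pose N := `|d - n%:Z|%N.
have N_gt0 : (0 < N)%N by rewrite absz_gt0 subr_eq0; exact/eqP.
pose cls (m : int) : set (R -> R) :=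
  [set h | lift_factor f h /\ lift_factor_equiv (E m) h]%classic.
have equivE m m' : lift_factor_equiv (E m) (E m') <-> (N%:Z %| m - m')%Z.
  rewrite (lift_factor_equivP m m' eE).
  rewrite (_ : (N%:Z %| _)%Z = (d - n%:Z %| m - m')%Z).
    split=> [[k ->]|/dvdzP[k kE]].
      by rewrite addrAC subrr add0r -opprB mulrN rpredN dvdz_mull.
    by exists (- k); rewrite mulNr -mulrN opprB -kE addrC subrK.
  by rewrite !dvdzE.
have clsE m m' : cls m = cls m' <-> (N%:Z %| m - m')%Z.
  split=> [mm'|mm'].
    have : cls m' (E m').
      split; first by apply/lfP; exists m'.
      by apply/equivE; rewrite subrr dvdz0.
    by rewrite -mm' => -[_ /equivE].
  rewrite eqEsubset; split => _ [/lfP[q ->] /equivE q1]; split;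
    try (by apply/lfP; exists q); apply/equivE.
    by rewrite -(subrKA m) rpredD// -opprB rpredN.
  by rewrite -(subrKA m') rpredD.
rewrite /reidemeister_number (_ : lift_factor_classes f =
    ((fun k : nat => cls k%:Z) @` `I_N)%classic); last first.
  rewrite eqEsubset; split => [_ [_ /lfP[m ->] <-]|_ [k _ <-]]; last first.
    by exists (E k%:Z) => //; apply/lfP; exists k%:Z.
  exists `|(m %% N%:Z)%Z|%N => /=.
    by rewrite -ltz_nat gez0_abs ?modz_ge0 ?ltz_pmod ?gt_eqF.
  apply/clsE; rewrite gez0_abs ?modz_ge0 ?gt_eqF//.
  by rewrite {2}(divz_eq m N%:Z) opprD addrCA subrr addr0 rpredN dvdz_mull.
rewrite (@counting_card _ _ _ N) ?abszE//.
apply: inj_card_eq => k l /set_mem /= kN /set_mem /= lN /clsE.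
rewrite -eqz_mod_dvd => /eqP.
by rewrite !modz_small//= => -[].
Qed.
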